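(* Let $p=2$, and let $G=U(2,2)$, $H\simeq GL_2(\mathbb{C})$ its symmetric subgroup, $P\subset G$ the Siegel parabolic subgroup, and $B\subset H$ the Borel subgroup, all realized as explicit matrix groups as in the context. Identify $G/P$ with $\operatorname{LM}^{\circ}_{4,2}/GL_2(\mathbb{C})$, and write $[M(C,D)]=M(C,D)\,GL_2(\mathbb{C})$ for the point of $G/P$ defined by $M(C,D)\in\operatorname{LM}^{\circ}_{4,2}$. Then a complete set of representatives (each orbit represented exactly once) of the orbit decomposition $$H\backslash (H/B\times G/P)\simeq B\backslash G/P$$ is given by the points $[M(C,D)]\in G/P$ with $(C,D)$ in the following list, where all choices of signs are allowed and are independent, and where $I=\begin{pmatrix}1&0\\0&1\end{pmatrix}$, $0$ is the zero $2\times 2$ matrix, $E_{1}=\begin{pmatrix}1&0\\0&0\end{pmatrix}$, $E_{2}=\begin{pmatrix}0&0\\0&1\end{pmatrix}$, $w=\begin{pmatrix}0&1\\1&0\end{pmatrix}$: 1. $\left(\begin{pmatrix}\epsilon_1&0\\0&\epsilon_2\end{pmatrix},\,I\right)$ with $\epsilon_1,\epsilon_2\in\{\pm1\}$ (4 points); 2. $(I,\ \pm E_{1})$ (2 points); 3. $(w,\ I)$ (1 point); 4. $(\pm E_{2},\ I)$ (2 points); 5. $(E_{2},\ E_{1})$ (1 point); 6. $(I,\ \pm E_{2})$ (2 points); 7. $(\pm E_{1},\ I)$ (2 points); 8. $(I,\ 0)$ (1 point); 9. $(E_{1},\ E_{2})$ (1 point); 10. $(0,\ I)$ (1 point). In particular,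 $\#(B\backslash G/P)=17$.
   Context: For $p\ge 1$ let $J_p=\sqrt{-1}\begin{pmatrix}0&-I_p\\ I_p&0\end{pmatrix}$, and let $(\cdot)^*$ denote conjugate transpose. Define - $G=U(p,p)=\{g\in GL_{2p}(\mathbb{C})\mid g^*J_pg=J_p\}$; - $H=\{\operatorname{diag}(g,(g^* )^{-1})\mid g\in GL_p(\mathbb{C})\}$ (block diagonal matrices); - $P=\left\{\begin{pmatrix}g&u\\0&(g^* )^{-1}\end{pmatrix}\,\middle|\,g\in GL_p(\mathbb{C}),\ g^{-1}u \text{ Hermitian}\right\}$; - $B=\{\operatorname{diag}(b,(b^* )^{-1})\mid b\in B_p\}$, where $B_p\subset GL_p(\mathbb{C})$ is the group of invertible upper triangular matrices. For $C,D\in \operatorname{M}_{p,p}(\mathbb{C})$ write $M(C,D)=\begin{pmatrix} C \\ D \end{pmatrix}\in\operatorname{M}_{2p,p}(\mathbb{C})$, and put $$\operatorname{LM}^{\circ}_{2p,p}=\{M(C,D)\mid C^*D=D^*C,\ \operatorname{rank}M(C,D)=p\}.$$ $G$ acts on $\operatorname{LM}^{\circ}_{2p,p}$ by left multiplication and $GL_p(\mathbb{C})$ acts by right multiplication. There is a $G$-equivariant isomorphism $G/P\simeq\operatorname{LM}^{\circ}_{2p,p}/GL_p(\mathbb{C})$, $gP\mapsto g\,M(I_p,0)\,GL_p(\mathbb{C})$; a point of the right-hand side corresponds to the maximal isotropic subspace (for the Hermitian form defined by $J_p$) spanned by the columns. $H$ acts diagonally on $H/B\times G/P$, and the bijection $B\backslash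 G/P\simeq H\backslash(H/B\times G/P)$ sends the $B$-orbit of $x\in G/P$ to the $H$-orbit of $(eB,x)$. *)

(* Defs.v *)
From HB Require Import structures.
From mathcomp Require Import all_boot all_order all_algebra.
From mathcomp Require Import complex.
From mathcomp Require Import boolp classical_sets functions cardinality reals.

Set Implicit Arguments.
Unset Strict Implicit.
Unset Printing Implicit Defensive.

Import Order.TTheory GRing.Theory Num.Theory.

Local Open Scope classical_set_scope.
Local Open Scope complex_scope.
Local Open Scope sesquilinear_scope.
Local Open Scope ring_scope.

Section Orbits.
Variables (X T : Type) (S : set X) (act : X -> T -> T).

Definition orbit (x : T) : set T := [set act s x | s in S].

Definition orbits (Y : set T) : set (set T) := [set orbit x | x in Y].

End Orbits.

Section MatrixCosets.
Variables (F : comUnitRingType) (n k : nat).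

Definition GL : set 'M[F]_n := [set a | a \in unitmx].

Definition ltranslate (g : 'M[F]_n) (X : set 'M[F]_(n, k)) : set 'M[F]_(n, k) :=
  [set g *m x | x in X].

End MatrixCosets.

(* The left cosets gL, for g in K; these are sets of matrices. *)
Definition lcosets (F : comUnitRingType) (n : nat) (K L : set 'M[F]_n) :
    set (set 'M[F]_n) :=
  [set ltranslate g L | g in K].

Section SplitUnitaryGroup.
Variables (R : realType) (p : nat).
Local Notation C := R[i].

Definition Jmx : 'M[C]_(p + p) :=
  'i%C *: block_mx 0 (- 1%:M) 1%:M 0.

Definition Upp : set 'M[C]_(p + p) :=
  [set g | g \in unitmx /\ g ^t* *m Jmx *m g = Jmx].

Definition levi (g : 'M[C]_p) : 'M[C]_(p + p) :=
  block_mx g 0 0 (invmx (g ^t*)).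

Definition Hgrp : set 'M[C]_(p + p) := [set levi g | g in @GL C p].

Definition Pgrp : set 'M[C]_(p + p) :=
  [set x | exists g u : 'M[C]_p,
     [/\ g \in unitmx, invmx g *m u \is hermsymmx
       & x = block_mx g u 0 (invmx (g ^t*))]].

(* is_trig_mx means lower triangular, hence the transpose *)
Definition borelGL : set 'M[C]_p :=
  [set b | b \in unitmx /\ is_trig_mx b^T].

Definition Bgrp : set 'M[C]_(p + p) := [set levi b | b in borelGL].

Definition GmodP : set (set 'M[C]_(p + p)) := lcosets Upp Pgrp.

Definition HmodB : set (set 'M[C]_(p + p)) := lcosets Hgrp Bgrp.

Definition LMcirc : set 'M[C]_(p + p, p) :=
  [set M | exists c d : 'M[C]_p,
     [/\ M = col_mx c d, c ^t* *m d = d ^t* *m c & \rank M = p]].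

Definition GLclass (M : 'M[C]_(p + p, p)) : set 'M[C]_(p + p, p) :=
  [set M *m a | a in @GL C p].

Definition LMmodGL : set (set 'M[C]_(p + p, p)) :=
  [set GLclass M | M in LMcirc].

(* The map G/P -> LM/GL, written on cosets so that no representative has to be
   chosen: it sends a coset X to the product set X M(I,0) GL. *)
Definition ident (X : set 'M[C]_(p + p)) : set 'M[C]_(p + p, p) :=
  [set M | exists g a : 'M[C]_(_),
     [/\ X g, a \in unitmx & M = g *m col_mx 1%:M 0 *m a]].

(* The coset in G/P that ident sends to M(c,d) GL, for M(c,d) in LMcirc. *)
Definition GP_point (c d : 'M[C]_p) : set 'M[C]_(p + p) :=
  [set g | Upp g /\ ident (ltranslate g Pgrp) = GLclass (col_mx c d)].

Definition diag_ltranslate (h : 'M[C]_(p + p))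
    (z : set 'M[C]_(p + p) * set 'M[C]_(p + p)) :=
  (ltranslate h z.1, ltranslate h z.2).

Definition Borbit : set 'M[C]_(p + p) -> set (set 'M[C]_(p + p)) :=
  orbit Bgrp (@ltranslate C (p + p) (p + p)).

Definition Horbit : set 'M[C]_(p + p) * set 'M[C]_(p + p) ->
    set (set 'M[C]_(p + p) * set 'M[C]_(p + p)) :=
  orbit Hgrp diag_ltranslate.

Definition BGP : set (set (set 'M[C]_(p + p))) :=
  orbits Bgrp (@ltranslate C (p + p) (p + p)) GmodP.

Definition HHBGP : set (set (set 'M[C]_(p + p) * set 'M[C]_(p + p))) :=
  orbits Hgrp diag_ltranslate (HmodB `*` GmodP).

(* The map B\G/P -> H\(H/B x G/P) induced by x |-> (eB, x), again written
   without choosing representatives. *)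
Definition orbit_corr (O : set (set 'M[C]_(p + p))) :
    set (set 'M[C]_(p + p) * set 'M[C]_(p + p)) :=
  \bigcup_(x in O) Horbit (Bgrp, x).

End SplitUnitaryGroup.

Section Representatives.
Variable R : realType.
Local Notation C := R[i].

Definition E1 : 'M[C]_2 := delta_mx 0 0.
Definition E2 : 'M[C]_2 := delta_mx 1 1.
Definition wmx : 'M[C]_2 := delta_mx 0 1 + delta_mx 1 0.

(* The booleans s, t encode signs: (-1) ^+ s is 1 or -1. *)
Inductive reps : 'M[C]_2 * 'M[C]_2 -> Prop :=
| rep1 (s t : bool) : reps ((-1) ^+ s *: E1 + (-1) ^+ t *: E2, 1%:M)
| rep2 (s : bool) : reps (1%:M, (-1) ^+ s *: E1)
| rep3 : reps (wmx, 1%:M)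
| rep4 (s : bool) : reps ((-1) ^+ s *: E2, 1%:M)
| rep5 : reps (E2, E1)
| rep6 (s : bool) : reps (1%:M, (-1) ^+ s *: E2)
| rep7 (s : bool) : reps ((-1) ^+ s *: E1, 1%:M)
| rep8 : reps (1%:M, 0)
| rep9 : reps (E1, E2)
| rep10 : reps (0, 1%:M).

End Representatives.

(* Main.v *)
Require Import Defs.
From HB Require Import structures.
From mathcomp Require Import all_boot all_order all_algebra.
From mathcomp Require Import complex.
From mathcomp Require Import boolp classical_sets functions cardinality reals.
From mathcomp Require Import ring.

Set Implicit Arguments.
Unset Strict Implicit.
Unset Printing Implicit Defensive.

Import Order.TTheory GRing.Theory Num.Theory.

Local Open Scope classical_set_scope.
Local Open Scope sesquilinear_scope.
Local Open Scope ring_scope.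

(** The group P is the stabiliser in G of the plane spanned by the columns of
    M(I,0) ([PgrpP]), and G is transitive on the maximal isotropic subspaces,
    because every M(C,D) is the left half of an explicit element of G
    ([LMcirc_transitive]).  Hence G/P is the space of Lagrangians, for every p.
    The bijection between B\G/P and H\(H/B x G/P) is formal: H acts
    transitively on H/B with stabiliser B ([orbit_corr_bij]).  What remains is
    to classify pairs (C,D) under (C,D) -> (b C a, b^{-*} D a) with b upper
    triangular and a invertible ([borel_equiv], [Borbit_GP_point]).

    For p = 2 write a point of a Lagrangian plane W as (x,y), x = C v, y = D v.
    The lower entry x_1 and the upper entry y_0 are the two coordinates that B
    only rescales.  If these two functionals are independent on W, or if one of
    them vanishes on W, then W can be moved by B to a split plane W_0 + W_1,
    with W_i a line in the plane of the coordinates (x_i, y_i).  Isotropy says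
    that each W_i is a real line, and the torus, which multiplies the slope
    y_i / x_i by a positive number, leaves four possibilities: slope 1, slope
    -1 and the two axes.  If x_1 and y_0 are proportional and both nonzero on
    W, the plane can be moved to the graph of w ([lagrangian2_reduce]).  This
    gives 4 * 4 + 1 = 17 normal forms.

    They are pairwise inequivalent because B preserves the values x^* y and the
    vanishing of x_1 and of y_0.  On a split plane the vectors with y_0 = 0 and
    x_1 <> 0 reveal the type of W_1 through the sign of x^* y, and those with
    x_1 = 0 and y_0 <> 0 reveal the type of W_0; the graph of w has vectors of
    neither kind, but it has vectors with x_1 and y_0 both nonzero, unlike the
    only split plane without vectors of these two kinds ([profiles_equiv],
    [split_profiles_lower], [split_profiles_upper], [split_profiles_neq]). *)

(** * Groups of matrices acting by translation *)

Lemma invmx_mul (F : comUnitRingType) (n : nat) (a b : 'M[F]_n) :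
  a \in unitmx -> b \in unitmx -> invmx (a *m b) = invmx b *m invmx a.
Proof.
move=> ua ub; have uab : a *m b \in unitmx by rewrite unitmx_mul ua.
apply: (can_inj (mulKmx uab)).
by rewrite mulmxV // mulmxA mulmxK // mulmxV.
Qed.

Section MatrixGroups.
Variables (F : comUnitRingType) (n : nat).
Implicit Types (K : set 'M[F]_n).

Definition mxgroup K :=
  [/\ K 1%:M, K `<=` [set a | a \in unitmx],
      (forall a b, K a -> K b -> K (a *m b))
    & (forall a, K a -> K (invmx a))].

Lemma GL_mxgroup : mxgroup (@GL F n).
Proof.
split; rewrite /GL //=; first exact: unitmx1.
- by move=> a b ua ub; rewrite unitmx_mul ua.
- by move=> a; rewrite unitmx_inv.
Qed.

Section Translates.
Variable k : nat.
Implicit Types (X : set 'M[F]_(n, k)).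

Lemma ltranslate1 X : ltranslate 1%:M X = X.
Proof.
rewrite /ltranslate -[RHS]image_id; apply: eq_imagel => x _.
by rewrite mul1mx.
Qed.

Lemma ltranslateM a b X : ltranslate (a *m b) X = ltranslate a (ltranslate b X).
Proof.
rewrite /ltranslate image_comp; apply: eq_imagel => x _ /=.
by rewrite mulmxA.
Qed.

Lemma ltranslateK a X : a \in unitmx -> ltranslate (invmx a) (ltranslate a X) = X.
Proof. by move=> ua; rewrite -ltranslateM mulVmx ?ltranslate1. Qed.

End Translates.

Lemma ltranslate_mem K a : mxgroup K -> K a -> ltranslate a K = K.
Proof.
case=> _ uK KM KV Ka; apply/seteqP; split=> [_ [x Kx <-]|x Kx].
  exact: KM.
exists (invmx a *m x); first by apply: KM => //; apply: KV.
by rewrite mulKVmx //; apply: uK.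
Qed.

Lemma mem_ltranslate K a : mxgroup K -> ltranslate a K a.
Proof. by case=> K1 _ _ _; exists 1%:M => //; rewrite mulmx1. Qed.

Lemma ltranslate_id K a : mxgroup K -> ltranslate a K = K <-> K a.
Proof.
move=> gK; split=> [<-|]; [exact: mem_ltranslate | exact: ltranslate_mem].
Qed.

Lemma orbit_eq (T : Type) K (act : 'M[F]_n -> T -> T) x y :
    mxgroup K -> (forall z, act 1%:M z = z) ->
    (forall a b z, act (a *m b) z = act a (act b z)) ->
  Defs.orbit K act x = Defs.orbit K act y <-> exists2 a, K a & act a x = y.
Proof.
move=> [K1 uK KM KV] act1 actM; split=> [eq_xy|[a Ka <-]].
  by have : Defs.orbit K act x y by rewrite eq_xy; exists 1%:M.
apply/seteqP; split=> _ [b Kb <-].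
  exists (b *m invmx a); first by apply: KM => //; apply: KV.
  by rewrite -actM mulmxKV //; apply: uK.
by exists (b *m a); [apply: KM | rewrite actM].
Qed.

End MatrixGroups.

(** * Conjugate transpose and Gram matrices *)

Section ConjugateTranspose.
Variable C : numClosedFieldType.

Lemma adjmxM (m n k : nat) (a : 'M[C]_(m, n)) (b : 'M[C]_(n, k)) :
  (a *m b)^t* = b^t* *m a^t*.
Proof. by rewrite trmx_mul map_mxM. Qed.

Lemma adj1mx (n : nat) : (1%:M : 'M[C]_n)^t* = 1%:M.
Proof. by rewrite trmx1 map_mx1. Qed.

Lemma adj0mx (m n : nat) : (0 : 'M[C]_(m, n))^t* = 0.
Proof. by rewrite trmx0 map_mx0. Qed.

Lemma adjmx_inv (n : nat) (a : 'M[C]_n) : (invmx a)^t* = invmx (a^t*).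
Proof. by rewrite trmx_inv map_invmx. Qed.

Lemma adjmx_unit (n : nat) (a : 'M[C]_n) : (a^t* \in unitmx) = (a \in unitmx).
Proof. by rewrite map_unitmx unitmx_tr. Qed.

Lemma adj_col_mx (m1 m2 n : nat) (c : 'M[C]_(m1, n)) (d : 'M[C]_(m2, n)) :
  (col_mx c d)^t* = row_mx (c^t*) (d^t*).
Proof. by rewrite tr_col_mx map_row_mx. Qed.

Lemma adj_block_mx (m1 m2 n1 n2 : nat) (a : 'M[C]_(m1, n1)) (b : 'M[C]_(m1, n2))
    (c : 'M[C]_(m2, n1)) (d : 'M[C]_(m2, n2)) :
  (block_mx a b c d)^t* = block_mx (a^t*) (c^t*) (b^t*) (d^t*).
Proof. by rewrite tr_block_mx map_block_mx. Qed.

Lemma gram_eq0 (m n : nat) (x : 'M[C]_(m, n)) : x *m x^t* = 0 -> x = 0.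
Proof.
move=> x0; apply/matrixP=> i j; rewrite mxE.
have := congr1 (fun y : 'M_m => y i i) x0; rewrite !mxE => /eqP.
rewrite psumr_eq0 => [/allP/(_ j)|k _]; last by rewrite !mxE mul_conjC_ge0.
by rewrite mem_index_enum !mxE mul_conjC_eq0 => /(_ isT)/eqP.
Qed.

Lemma gram_unit (m n : nat) (x : 'M[C]_(m, n)) :
  (x^t* *m x \in unitmx) = (\rank x == n).
Proof.
apply/idP/eqP=> [|rkx].
  rewrite -row_full_unit => /eqP rk; apply/eqP.
  by rewrite eqn_leq rank_leq_col -{1}rk mxrankM_maxr.
rewrite -row_free_unit -kermx_eq0; apply/eqP.
set v := kermx _.
have vx0 : v *m (x^t* *m x) = 0 by rewrite mulmx_ker.
have : (v *m x^t*) *m (v *m x^t*)^t* = 0.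
  by rewrite adjmxM trmxCK !mulmxA -[X in X *m _]mulmxA vx0 mul0mx.
move/gram_eq0/eqP; rewrite mulmx_free_eq0 => [/eqP //|].
by rewrite /row_free mxrank_map mxrank_tr rkx.
Qed.

End ConjugateTranspose.

(** * The Lagrangian model of G/P, and B-orbits *)

(** The action of diag(b, b^{-*}) on the left and of a on the right.  Moving
    b^* to the other side of the second equation avoids an inverse, so that the
    relation can be checked by polynomial identities. *)
Definition borel_equiv (C : numClosedFieldType) (p : nat) (M M' : 'M[C]_p * 'M[C]_p) :=
  exists b a, [/\ b \in unitmx, is_trig_mx b^T, a \in unitmx, M'.1 = b *m M.1 *m a
                & b^t* *m M'.2 = M.2 *m a].

Section SplitUnitary.
Variables (R : realType) (p : nat).
Local Notation C := R[i].
Implicit Types (g h : 'M[C]_(p + p)) (a b c d : 'M[C]_p) (M : 'M[C]_(p + p, p)).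

Local Notation J := (Jmx R p).
Local Notation U := (@Upp R p).
Local Notation P := (@Pgrp R p).
Local Notation H := (@Hgrp R p).
Local Notation M0 := (col_mx 1%:M 0 : 'M[C]_(p + p, p)).

Lemma iC_neq0 : ('i%C : C) != 0.
Proof. by rewrite eq_complex /= oner_eq0 andbF. Qed.

Lemma Jform_col c d c' d' :
  (col_mx c d)^t* *m J *m col_mx c' d' = 'i%C *: (d^t* *m c' - c^t* *m d').
Proof.
rewrite adj_col_mx /Jmx -scalemxAr -scalemxAl; congr (_ *: _).
rewrite mul_row_block !mulmx0 add0r addr0 mul_row_col mulmx1 mulmxN mulmx1.
by rewrite mulNmx addrC.
Qed.

(** Invertibility of g is a consequence of g^* J g = J, since det J <> 0; the
    fourth block equation is the adjoint of the third. *)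
Lemma UppP a b c d :
  U (block_mx a b c d) <->
  [/\ a^t* *m c = c^t* *m a, b^t* *m d = d^t* *m b & a^t* *m d - c^t* *m b = 1%:M].
Proof.
have JE : (block_mx a b c d)^t* *m J *m block_mx a b c d =
    'i%C *: block_mx (c^t* *m a - a^t* *m c) (c^t* *m b - a^t* *m d)
                     (d^t* *m a - b^t* *m c) (d^t* *m b - b^t* *m d).
  rewrite adj_block_mx /Jmx -scalemxAr -scalemxAl; congr (_ *: _).
  rewrite mulmx_block !mulmx0 !add0r !addr0 mulmx_block !mulmx1 !mulmxN !mulmx1.
  by rewrite !mulNmx.
have cancel_i (x y : 'M[C]_(p + p)) : 'i%C *: x = 'i%C *: y -> x = y.
  by move/(scalerI iC_neq0).
have Junit : block_mx 0 (- 1%:M) 1%:M 0 \in @unitmx C (p + p).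
  have := @mulmx1_unit _ _ (block_mx 0 1%:M (- 1%:M) 0 : 'M[C]_(p + p))
    (block_mx 0 (- 1%:M) 1%:M 0).
  case=> //; rewrite mulmx_block !mulmx0 !mul0mx !add0r !addr0 mulmx1 mulmxN.
  by rewrite mulNmx mulmx1 opprK -scalar_mx_block.
split=> [[_]|[ac bd abcd]].
  rewrite JE => /cancel_i/eq_block_mx [/subr0_eq-> E _ /subr0_eq->].
  by split=> //; rewrite -[LHS]opprB E opprK.
have E : (block_mx a b c d)^t* *m J *m block_mx a b c d = J.
  rewrite JE /Jmx ac bd !subrr -[c^t* *m b - _]opprB abcd.
  congr (_ *: block_mx _ _ _ _).
  rewrite -[1%:M]adj1mx -abcd linearB map_mxB !adjmxM !trmxCK //.
split; last exact: E.
rewrite /= unitmxE unitfE; apply/negP => /eqP g0.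
have := congr1 determinant E; rewrite det_mulmx g0 mulr0 => /esym/eqP.
rewrite /Jmx detZ mulf_eq0 expf_eq0 (negPf iC_neq0) andbF /=.
by move: Junit; rewrite unitmxE unitfE => /negPf->.
Qed.

Lemma Upp_mxgroup : mxgroup U.
Proof.
split; rewrite /Upp /=.
- by rewrite unitmx1 adj1mx mul1mx mulmx1.
- by move=> g [].
- move=> g h [ug gJ] [uh hJ]; rewrite unitmx_mul ug uh; split=> //.
  by rewrite adjmxM !mulmxA -(mulmxA (h^t*)) -(mulmxA (h^t*)) gJ.
- move=> g [ug gJ]; rewrite unitmx_inv ug; split=> //.
  rewrite -{1}gJ !mulmxA -adjmxM mulmxV // adj1mx mul1mx.
  by rewrite -mulmxA mulmxV ?mulmx1.
Qed.

(** Membership in terms of J, a form in which left multiplication by G is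
    harmless. *)
Lemma LMcircP M : LMcirc M <-> M^t* *m J *m M = 0 /\ \rank M = p.
Proof.
split=> [[c [d [-> cd rk]]]|[]].
  by rewrite Jform_col cd subrr scaler0.
rewrite -[M]vsubmxK Jform_col => /eqP.
rewrite scaler_eq0 (negPf iC_neq0) subr_eq0 => /eqP dc rk.
by exists (usubmx M), (dsubmx M); rewrite dc.
Qed.

Lemma LMcirc_mull g M : U g -> LMcirc M -> LMcirc (g *m M).
Proof.
move=> [ug gJ] /LMcircP[MJ rk]; apply/LMcircP.
rewrite adjmxM !mulmxA -(mulmxA (M^t*)) -(mulmxA (M^t*)) gJ MJ; split=> //.
by rewrite (eqmxMfull _ _) ?row_full_unit.
Qed.

Lemma mul_block_M0 a b c d : block_mx a b c d *m M0 = col_mx a c.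
Proof. by rewrite mul_block_col !mulmx1 !mulmx0 !addr0. Qed.

Lemma levi_col b c d : levi b *m col_mx c d = col_mx (b *m c) (invmx (b^t*) *m d).
Proof. by rewrite mul_block_col !mul0mx addr0 add0r. Qed.

(** P is the stabiliser of the point M(I,0) GL of LM/GL.  That P is a group
    follows from this without any block computation. *)
Lemma PgrpP g : P g <-> U g /\ exists2 a, a \in unitmx & g *m M0 = M0 *m a.
Proof.
have M0E a : M0 *m a = col_mx a 0 by rewrite mul_col_mx mul1mx mul0mx.
split=> [[a [u [ua /is_hermitianmxP hu ->]]]|[]].
  split; last by exists a => //; rewrite M0E mul_block_M0.
  apply/UppP; rewrite adj0mx !mulmx0 !mul0mx subr0.
  have uat : a^t* \in unitmx by rewrite adjmx_unit.
  rewrite mulmxV //; split=> //.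
  move: hu; rewrite expr0 scale1r adjmxM adjmx_inv => hu.
  by rewrite adjmx_inv trmxCK.
rewrite -[g]submxK; set a := ulsubmx g; set b := ursubmx g; set d := drsubmx g.
move=> + [x ux]; rewrite mul_block_M0 M0E => + /eq_col_mx[ax c0].
rewrite c0 => /UppP; rewrite adj0mx !mul0mx mulmx0 subr0 => -[_ bd ad].
have [uat ud] := mulmx1_unit ad.
have dE : d = invmx (a^t*) by rewrite -[d](mulKmx uat) ad mulmx1.
exists a, b; rewrite {1}ax -dE; split=> //.
apply/is_hermitianmxP; rewrite expr0 scale1r adjmxM adjmx_inv -dE bd.
by rewrite dE adjmx_inv trmxCK.
Qed.

Lemma Pgrp_sub : P `<=` U.
Proof. by move=> g /PgrpP[]. Qed.

Lemma Pgrp_mxgroup : mxgroup P.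
Proof.
have [U1 uU UM UV] := Upp_mxgroup.
split.
- apply/PgrpP; split=> //; exists 1%:M; first exact: unitmx1.
  by rewrite mul1mx mulmx1.
- by move=> g /Pgrp_sub/uU.
- move=> g h /PgrpP[Ug [a ua ga]] /PgrpP[Uh [b ub hb]]; apply/PgrpP.
  split; first exact: UM.
  by exists (a *m b); rewrite ?unitmx_mul ?ua // -mulmxA hb !mulmxA ga.
- move=> g /PgrpP[Ug [a ua ga]]; apply/PgrpP; split; first exact: UV.
  exists (invmx a); first by rewrite unitmx_inv.
  by rewrite -{1}[M0](mulmxK ua) -ga -mulmxA mulKmx //; apply: uU.
Qed.

Lemma levi_Pgrp b : b \in unitmx -> P (levi b).
Proof.
move=> ub; exists b, 0; split=> //; rewrite mulmx0.
by apply/is_hermitianmxP; rewrite adj0mx scaler0.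
Qed.

Lemma leviM a b : a \in unitmx -> b \in unitmx -> levi (a *m b) = levi a *m levi b.
Proof.
move=> ua ub; rewrite /levi mulmx_block !mulmx0 !mul0mx !addr0 !add0r adjmxM.
by rewrite invmx_mul ?adjmx_unit.
Qed.

Lemma levi_mxgroup (L : set 'M[C]_p) : mxgroup L -> mxgroup [set levi b | b in L].
Proof.
move=> [L1 uL LM LV].
have [_ uP _ _] := Pgrp_mxgroup.
have levi1 : levi 1%:M = 1%:M :> 'M[C]_(p + p).
  by rewrite /levi adj1mx invmx1 -scalar_mx_block.
split.
- by exists 1%:M.
- by move=> _ [b /uL ub <-]; apply/uP/levi_Pgrp.
- move=> _ _ [a La <-] [b Lb <-]; exists (a *m b); first exact: LM.
  by rewrite leviM //; apply: uL.
- move=> _ [b Lb <-]; exists (invmx b); first exact: LV.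
  have ub := uL _ Lb.
  have ulb : levi b \in unitmx by apply/uP/levi_Pgrp.
  rewrite -[LHS](mulKmx ulb) -leviM ?unitmx_inv // mulmxV // levi1.
  exact: mulmx1.
Qed.

Lemma Hgrp_mxgroup : mxgroup H.
Proof. exact/levi_mxgroup/GL_mxgroup. Qed.

Lemma Hgrp_sub : H `<=` U.
Proof. by move=> _ [b ub <-]; apply/Pgrp_sub/levi_Pgrp. Qed.

Lemma ltranslate_GLclass g M : ltranslate g (GLclass M) = GLclass (g *m M).
Proof.
rewrite /ltranslate /GLclass image_comp; apply: eq_imagel => a _ /=.
by rewrite mulmxA.
Qed.

Lemma GLclass_eq M M' :
  GLclass M = GLclass M' <-> exists2 a, a \in unitmx & M' = M *m a.
Proof.
split=> [eqM|[a ua ->]].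
  have : GLclass M M' by rewrite eqM; exists 1%:M; rewrite ?mulmx1 //= /GL /= unitmx1.
  by case=> a ua <-; exists a.
apply/seteqP; split=> _ [b ub <-].
  exists (invmx a *m b); last by rewrite mulmxA mulmxK.
  by rewrite /GL /= unitmx_mul unitmx_inv ua.
exists (a *m b); last by rewrite mulmxA.
by rewrite /GL /= unitmx_mul ua.
Qed.

Lemma ident_coset g : ident (ltranslate g P) = GLclass (g *m M0).
Proof.
have [P1 uP PM PV] := Pgrp_mxgroup.
apply/seteqP; split=> [_ [_ [a [[h /PgrpP[_ [b ub hb]] <-] ua ->]]]|_ [a ua <-]].
  exists (b *m a); first by rewrite /GL /= unitmx_mul ub.
  by rewrite -(mulmxA g h) hb !mulmxA.
by exists g, a; split=> //; apply: mem_ltranslate.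
Qed.

Lemma coset_eq g h : g \in unitmx -> h \in unitmx ->
  ltranslate g P = ltranslate h P <-> P (invmx g *m h).
Proof.
move=> ug uh; rewrite -(ltranslate_id _ Pgrp_mxgroup) ltranslateM.
split=> [<-|E]; first exact: ltranslateK.
by rewrite -[in LHS]E -ltranslateM mulmxV // ltranslate1.
Qed.

Lemma ident_inj : set_inj (@GmodP R p) (@ident R p).
Proof.
have [_ uU UM UV] := Upp_mxgroup.
move=> X Y /set_mem[g Ug <-] /set_mem[h Uh <-].
rewrite !ident_coset => /GLclass_eq[a ua hg].
apply/coset_eq; [exact: uU.. |].
apply/PgrpP; split; first by apply: UM => //; apply: UV.
by exists a => //; rewrite -mulmxA hg -mulmxA mulKmx //; apply: uU.
Qed.

Lemma ident_ltranslate g X : GmodP X ->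
  ident (ltranslate g X) = ltranslate g (ident X).
Proof.
move=> [h Uh <-]; rewrite -ltranslateM !ident_coset ltranslate_GLclass.
by rewrite mulmxA.
Qed.

(** Witt's theorem in this case: with s = c^* c + d^* d, the Gram matrix of
    M(c,d), the columns of M(-d s^{-1}, c s^{-1}) span a complementary
    Lagrangian in duality with the given one, so that the two together form an
    element of G. *)
Lemma LMcirc_transitive M : LMcirc M -> exists2 g, U g & g *m M0 = M.
Proof.
move=> [c [d [-> cd rk]]].
have := gram_unit (col_mx c d); rewrite rk eqxx adj_col_mx mul_row_col.
set s := _ + _ => us.
have sadj : s^t* = s by rewrite /s linearD map_mxD !adjmxM !trmxCK.
exists (block_mx c (- d *m invmx s) d (c *m invmx s)); last exact: mul_block_M0.
apply/UppP; split=> //; last first.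
  by rewrite !mulNmx mulmxN opprK !mulmxA -mulmxDl mulmxV.
rewrite !mulNmx linearN map_mxN mulNmx mulmxN !adjmxM adjmx_inv sadj.
by rewrite !mulmxA -(mulmxA _ (d^t*)) -(mulmxA _ (c^t*)) cd.
Qed.

Lemma M0_LMcirc : LMcirc M0.
Proof.
exists 1%:M, 0; rewrite adj0mx mulmx0 mul0mx; split=> //.
have E : row_mx 1%:M (0 : 'M_p) *m M0 = 1%:M.
  by rewrite mul_row_col mulmx1 mulmx0 addr0.
have := mxrankM_maxr (row_mx 1%:M (0 : 'M_p)) M0.
by rewrite E mxrank1 => le_p; apply/eqP; rewrite eqn_leq rank_leq_col.
Qed.

Lemma ident_bij : set_bij (@GmodP R p) (@LMmodGL R p) (@ident R p).
Proof.
split.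
- move=> _ [g Ug <-]; rewrite ident_coset; exists (g *m M0) => //.
  exact/LMcirc_mull/M0_LMcirc.
- exact: ident_inj.
- move=> _ [M /LMcirc_transitive[g Ug <-] <-]; exists (ltranslate g P).
    by exists g.
  exact: ident_coset.
Qed.

Lemma GmodP_ltranslate g X : U g -> GmodP X -> GmodP (ltranslate g X).
Proof.
have [_ _ UM _] := Upp_mxgroup.
by move=> Ug [h Uh <-]; exists (g *m h); rewrite ?ltranslateM //; apply: UM.
Qed.

(** The set GP_point c d, defined by a condition on its elements, is a single
    coset because ident is injective. *)
Lemma GP_point_coset c d g : U g -> g *m M0 = col_mx c d ->
  GP_point c d = ltranslate g P.
Proof.
have [_ _ UM _] := Upp_mxgroup.
move=> Ug gM; apply/seteqP; split=> [h [Uh]|_ [x Px <-]].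
  rewrite -gM -ident_coset => /ident_inj <-; first exact/mem_ltranslate/Pgrp_mxgroup.
    by apply/mem_set; exists h.
  by apply/mem_set; exists g.
split; first by apply: UM => //; apply: Pgrp_sub.
by rewrite -gM -ident_coset ltranslateM (ltranslate_mem Pgrp_mxgroup Px).
Qed.

Lemma GP_pointP c d : LMcirc (col_mx c d) ->
  GmodP (GP_point c d) /\ ident (GP_point c d) = GLclass (col_mx c d).
Proof.
move=> /LMcirc_transitive[g Ug gM]; rewrite (GP_point_coset Ug gM).
by rewrite ident_coset gM; split=> //; exists g.
Qed.

Section BorelOrbits.
Hypothesis Bgroup : mxgroup (@borelGL R p).

Local Notation B := (@Bgrp R p).

Let BU : B `<=` U.
Proof. by move=> _ [b [ub _] <-]; apply: Hgrp_sub; exists b. Qed.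

Let BH : B `<=` H.
Proof. by move=> _ [b [ub _] <-]; exists b. Qed.

Lemma Bgrp_mxgroup : mxgroup B.
Proof. exact: levi_mxgroup. Qed.

Lemma Borbit_eq X Y :
  @Borbit R p X = Borbit Y <-> exists2 b, B b & ltranslate b X = Y.
Proof.
apply: orbit_eq; [exact: Bgrp_mxgroup | exact: ltranslate1 | exact: ltranslateM].
Qed.

Lemma Horbit_eq z z' :
  @Horbit R p z = Horbit z' <-> exists2 h, H h & diag_ltranslate h z = z'.
Proof.
apply: orbit_eq => [|[X Y]|g h [X Y]]; first exact: Hgrp_mxgroup.
  by rewrite /diag_ltranslate /= !ltranslate1.
by rewrite /diag_ltranslate /= !ltranslateM.
Qed.

Lemma orbit_corr_Borbit X : orbit_corr (Borbit X) = Horbit (B, X).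
Proof.
have gB := Bgrp_mxgroup.
apply/seteqP; split=> [z [_ [b Bb <-]]|z Hz]; last first.
  exists X => //; exists 1%:M; [by case: gB | exact: ltranslate1].
suff -> : Horbit (B, ltranslate b X) = Horbit (B, X) by [].
apply/esym/Horbit_eq; exists b; first exact: BH.
by rewrite /diag_ltranslate /= ltranslate_mem.
Qed.

(** Every H-orbit meets {eB} x G/P because H is transitive on H/B, and it meets
    it in one B-orbit because B is the stabiliser of eB. *)
Lemma orbit_corr_bij : set_bij (@BGP R p) (@HHBGP R p) (@orbit_corr R p).
Proof.
have gB := Bgrp_mxgroup; have [H1 uH HM HV] := Hgrp_mxgroup.
split.
- move=> _ [X GX <-]; rewrite orbit_corr_Borbit.
  exists (B, X) => //; split=> //; exists 1%:M => //; exact: ltranslate1.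
- move=> _ _ /set_mem[X GX <-] /set_mem[Y GY <-].
  rewrite !orbit_corr_Borbit => /Horbit_eq[h Hh [/(ltranslate_id _ gB) Bh hX]].
  by apply/Borbit_eq; exists h.
- move=> _ [[Y X] [/= [h Hh <-] GX] <-]; exists (Borbit (ltranslate (invmx h) X)).
    exists (ltranslate (invmx h) X) => //; apply: GmodP_ltranslate => //.
    exact/Hgrp_sub/HV.
  rewrite orbit_corr_Borbit; apply/Horbit_eq; exists h => //.
  by rewrite /diag_ltranslate /= -ltranslateM mulmxV ?ltranslate1 //; apply: uH.
Qed.

(** Transport of the B-action through ident: orbits in G/P become classes of
    pairs of p x p matrices. *)
Lemma Borbit_GP_point c d c' d' :
    LMcirc (col_mx c d) -> LMcirc (col_mx c' d') ->
  Borbit (GP_point c d) = Borbit (GP_point c' d') <-> borel_equiv (c, d) (c', d').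
Proof.
move=> /GP_pointP[GX iX] /GP_pointP[GY iY].
have levi_class b : borelGL b ->
    ltranslate (levi b) (GP_point c d) = GP_point c' d' <->
    exists2 a, a \in unitmx & c' = b *m c *m a /\ b^t* *m d' = d *m a.
  move=> Bb; have Ub : U (levi b) by apply: BU; exists b.
  have ubt : b^t* \in unitmx by rewrite adjmx_unit; case: Bb.
  have -> : ltranslate (levi b) (GP_point c d) = GP_point c' d' <->
      GLclass (levi b *m col_mx c d) = GLclass (col_mx c' d').
    rewrite -iY -ltranslate_GLclass -iX -ident_ltranslate //.
    split=> [-> //|/ident_inj -> //]; apply/mem_set => //.
    exact: GmodP_ltranslate.
  rewrite GLclass_eq levi_col; split=> -[a ua].
    rewrite mul_col_mx => /eq_col_mx[-> ->]; exists a => //.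
    by split=> //; rewrite -mulmxA mulKVmx.
  by move=> [-> da]; exists a => //; rewrite mul_col_mx -(mulmxA (invmx _)) -da mulKmx.
split=> [/Borbit_eq[_ [b Bb <-] /(levi_class _ Bb)[a ua [cE dE]]]|].
  by case: Bb => ub trb; exists b, a.
move=> [b [a [ub trb ua cE dE]]]; have Bb : borelGL b by []; apply/Borbit_eq.
by exists (levi b); [exists b | apply/levi_class => //; exists a].
Qed.

End BorelOrbits.

End SplitUnitary.

(** * Two by two matrices *)

Section TwoByTwo.
Variable F : fieldType.

Definition mx2 (x y z t : F) : 'M[F]_2 :=
  \matrix_(i, j) (if i == 0 then if j == 0 then x else y
                  else if j == 0 then z else t).

Lemma mx2_ext (m m' : 'M[F]_2) :
  m 0 0 = m' 0 0 -> m 0 1 = m' 0 1 -> m 1 0 = m' 1 0 -> m 1 1 = m' 1 1 -> m = m'.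
Proof.
move=> e00 e01 e10 e11; apply/matrixP=> i j.
have two (k : 'I_2) : k = 0 \/ k = 1.
  by case: k => [[|[|k]] ltk] //; [left | right]; apply/val_inj.
by have [->|->] := two i; have [->|->] := two j.
Qed.

Lemma mx2E (m : 'M[F]_2) : m = mx2 (m 0 0) (m 0 1) (m 1 0) (m 1 1).
Proof. by apply: mx2_ext; rewrite !mxE. Qed.

Lemma mx2_inj x y z t x' y' z' t' :
  mx2 x y z t = mx2 x' y' z' t' -> [/\ x = x', y = y', z = z' & t = t'].
Proof.
by move=> E; split; [have := congr1 (fun m : 'M_2 => m 0 0) E
  | have := congr1 (fun m : 'M_2 => m 0 1) E
  | have := congr1 (fun m : 'M_2 => m 1 0) E
  | have := congr1 (fun m : 'M_2 => m 1 1) E]; rewrite !mxE.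
Qed.

Lemma mx2M x y z t x' y' z' t' :
  mx2 x y z t *m mx2 x' y' z' t' =
  mx2 (x * x' + y * z') (x * y' + y * t') (z * x' + t * z') (z * y' + t * t').
Proof. by apply: mx2_ext; rewrite !mxE !big_ord_recl big_ord0 !mxE /= addr0. Qed.

Lemma mulmx2 (m n : nat) (a : 'M[F]_(m, 2)) (b : 'M[F]_(2, n)) i j :
  (a *m b) i j = a i 0 * b 0 j + a i 1 * b 1 j.
Proof.
rewrite mxE !big_ord_recl big_ord0 addr0.
by have -> : lift ord0 ord0 = 1 :> 'I_2 by apply/val_inj.
Qed.

Lemma mx2D x y z t x' y' z' t' :
  mx2 x y z t + mx2 x' y' z' t' = mx2 (x + x') (y + y') (z + z') (t + t').
Proof. by apply: mx2_ext; rewrite !mxE. Qed.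

Lemma mx2_1 : 1%:M = mx2 1 0 0 1.
Proof. by apply: mx2_ext; rewrite !mxE. Qed.

Lemma mx2_0 : 0 = mx2 0 0 0 0.
Proof. by apply: mx2_ext; rewrite !mxE. Qed.

Lemma det_mx2 x y z t : \det (mx2 x y z t) = x * t - y * z.
Proof.
rewrite (expand_det_row _ 0) !big_ord_recl big_ord0 /cofactor !det_mx11 !mxE /=.
by rewrite !mul1r addr0 mulN1r mulrN.
Qed.

Lemma mx2_unit x y z t : (mx2 x y z t \in unitmx) = (x * t - y * z != 0).
Proof. by rewrite unitmxE unitfE det_mx2. Qed.

Lemma mx2_trig x y z t : is_trig_mx (mx2 x y z t)^T = (z == 0).
Proof.
apply/is_trig_mxP/eqP => [/(_ 0 1 isT)|-> [[|[|i]] lti] [[|[|j]] ltj]] //.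
  by rewrite !mxE.
by rewrite !mxE.
Qed.

Lemma row2_reduce (x y : F) : (x != 0) || (y != 0) ->
  exists2 a, a \in unitmx & forall z t, exists u v, mx2 x y z t *m a = mx2 1 0 u v.
Proof.
have [->|x0 _] := eqVneq x 0 => [/= y0|].
  exists (mx2 0 1 y^-1 0) => [|z t].
    by rewrite mx2_unit mul0r mul1r sub0r oppr_eq0 invr_eq0.
  by rewrite mx2M; eexists; eexists; congr mx2; field.
exists (mx2 x^-1 (- y) 0 x) => [|z t].
  by rewrite mx2_unit mulVf // mulr0 subr0 oner_eq0.
by rewrite mx2M; eexists; eexists; congr mx2; field.
Qed.

(** Reduced column echelon forms, with the columns swapped in the invertible
    case to suit the order of the basis in which it is used. *)
Lemma col_echelon2 (m : 'M[F]_2) : exists2 a, a \in unitmx &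
  [\/ m *m a = mx2 0 1 1 0, m *m a = mx2 0 0 0 0, m *m a = mx2 0 0 1 0
    | exists l, m *m a = mx2 1 0 l 0].
Proof.
have [um|] := boolP (m \in unitmx).
  exists (invmx m *m mx2 0 1 1 0); last by constructor 1; rewrite mulKVmx.
  by rewrite unitmx_mul unitmx_inv um mx2_unit mul0r mul1r sub0r oppr_eq0 oner_eq0.
rewrite [m]mx2E; set x := m 0 0; set y := m 0 1; set z := m 1 0; set t := m 1 1.
move: x y z t => x y z t; rewrite unitmxE unitfE negbK => /eqP m0.
have [|] := boolP ((x != 0) || (y != 0)).
  move=> /row2_reduce[a ua /(_ z t)[u [v ma]]]; exists a => //; constructor 4.
  exists u; rewrite ma; congr mx2.
  by have := det_mulmx (mx2 x y z t) a; rewrite ma m0 mul0r det_mx2 mul0r mul1r subr0.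
rewrite negb_or !negbK => /andP[/eqP-> /eqP->].
have [|] := boolP ((z != 0) || (t != 0)).
  move=> /row2_reduce[a ua /(_ 0 0)[u [v]]]; rewrite [a]mx2E in ua *.
  rewrite mx2M => /mx2_inj[e1 e2 _ _].
  exists (mx2 (a 0 0) (a 0 1) (a 1 0) (a 1 1)) => //; constructor 3.
  by rewrite mx2M e1 e2; congr mx2; ring.
rewrite negb_or !negbK => /andP[/eqP-> /eqP->]; exists 1%:M; first exact: unitmx1.
by constructor 2; rewrite mulmx1.
Qed.

End TwoByTwo.

(** * Reduction of a Lagrangian plane to normal form *)

Section Classification.
Variable C : numClosedFieldType.
Implicit Types (M : 'M[C]_2 * 'M[C]_2).

Lemma adj_mx2 (x y z t : C) : (mx2 x y z t)^t* = mx2 x^* z^* y^* t^*.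
Proof. by apply: mx2_ext; rewrite !mxE. Qed.

Lemma trig_tr2 (b : 'M[C]_2) : is_trig_mx b^T = (b 1 0 == 0).
Proof. by rewrite {1}[b]mx2E mx2_trig. Qed.

Lemma borel_equiv_trans M M' M'' :
  borel_equiv M M' -> borel_equiv M' M'' -> borel_equiv M M''.
Proof.
move=> [b [a [ub tb ua cE dE]]] [b' [a' [ub' tb' ua' cE' dE']]].
exists (b' *m b), (a *m a'); rewrite !unitmx_mul ub ub' ua ua'; split=> //.
- move: tb tb'; rewrite !trig_tr2 mulmx2 => /eqP-> /eqP->.
  by rewrite mul0r mulr0 addr0.
- by rewrite cE' cE !mulmxA.
- by rewrite adjmxM -mulmxA dE' !mulmxA dE.
Qed.

Lemma borel_equiv_refl M : borel_equiv M M.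
Proof.
exists 1%:M, 1%:M; rewrite unitmx1 adj1mx !mul1mx !mulmx1 trig_tr2 mxE.
by split.
Qed.

Lemma borel_equiv_mulr (c d a c' d' : 'M[C]_2) : a \in unitmx ->
  c *m a = c' -> d *m a = d' -> borel_equiv (c, d) (c', d').
Proof.
move=> ua <- <-; exists 1%:M, a; rewrite unitmx1 adj1mx !mul1mx trig_tr2 mxE.
by split.
Qed.

(** The four classes of real lines in C^2 under positive rescaling of the
    slope: [inl s] for slope (-1)^s, [inr true] for the axis y = 0 and
    [inr false] for the axis x = 0. *)
Definition rline : Type := bool + bool.

Definition on_rline (t : rline) (c d : C) : bool :=
  match t with
  | inl s => (c != 0) && (d == (-1) ^+ s * c)
  | inr true => (c != 0) && (d == 0)
  | inr false => (c == 0) && (d != 0)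
  end.

Lemma signr_conj (s : bool) : ((-1) ^+ s : C)^* = (-1) ^+ s.
Proof. by rewrite rmorphXn rmorphN1. Qed.

(** The case p = 1.  An element (b, b^{-*}) divides the slope by |b|^2, so a
    real slope r can be brought to its sign with b = sqrt |r|. *)
Lemma rline_transitive (c d : C) : (c != 0) || (d != 0) -> c^* * d = d^* * c ->
  exists t, forall c' d', on_rline t c' d' ->
    exists b a, [/\ b != 0, a != 0, c' = b * c * a & b^* * d' = d * a].
Proof.
have [-> /= d0 _|c0 _ cd] := eqVneq c 0.
  exists (inr false) => c' d' /= /andP[/eqP-> d'0]; exists 1, (d' / d).
  rewrite oner_neq0 mulf_neq0 ?invr_eq0 // rmorph1 mulr0 mul0r mul1r.
  by split=> //; field.
have [->|d0] := eqVneq d 0.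
  exists (inr true) => c' d' /= /andP[c'0 /eqP->]; exists 1, (c' / c).
  rewrite oner_neq0 mulf_neq0 ?invr_eq0 // mulr0 mul0r mul1r.
  by split=> //; field.
have cc0 : c^* != 0 by rewrite conjC_eq0.
have real_dc : d / c \is Num.real.
  apply/CrealP; rewrite rmorphM fmorphV /=.
  by apply/eqP; rewrite eqr_div // -cd mulrC.
set r := d / c in real_dc; have r0 : r != 0 by rewrite mulf_neq0 ?invr_eq0.
have dE : d = r * c by rewrite mulfVK.
exists (inl (r < 0)) => c' d' /= /andP[c'0 /eqP->].
have [q q0 [qr qq]] : exists2 q : C, q != 0 & q^* = q /\ r = (-1) ^+ (r < 0)%R * q ^+ 2.
  exists (sqrtC `|r|); first by rewrite sqrtC_eq0 normr_eq0.
  split; first by apply/CrealP/ger0_real; rewrite sqrtC_ge0.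
  by rewrite sqrtCK -realEsign.
exists q, (c' / (q * c)); rewrite qr; split=> //.
- by rewrite mulf_neq0 // invr_eq0 mulf_neq0.
- by field; rewrite c0 q0.
- by rewrite dE [in RHS]qq; field; rewrite c0 q0.
Qed.

Definition split_pair (c0 c1 d0 d1 : C) : 'M[C]_2 * 'M[C]_2 :=
  (mx2 c0 0 0 c1, mx2 d0 0 0 d1).

Lemma split_pair_transitive (c0 c1 d0 d1 : C) :
    (c0 != 0) || (d0 != 0) -> c0^* * d0 = d0^* * c0 ->
    (c1 != 0) || (d1 != 0) -> c1^* * d1 = d1^* * c1 ->
  exists t0 t1, forall c0' c1' d0' d1',
    on_rline t0 c0' d0' -> on_rline t1 c1' d1' ->
    borel_equiv (split_pair c0 c1 d0 d1) (split_pair c0' c1' d0' d1').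
Proof.
move=> n0 r0 n1 r1.
have [t0 tr0] := rline_transitive n0 r0; have [t1 tr1] := rline_transitive n1 r1.
exists t0, t1 => c0' c1' d0' d1' /tr0[b0 [a0 [nb0 na0 -> e0]]].
move=> /tr1[b1 [a1 [nb1 na1 -> e1]]].
exists (mx2 b0 0 0 b1), (mx2 a0 0 0 a1).
rewrite !mx2_unit !mulr0 !subr0 !mulf_neq0 // mx2_trig eqxx adj_mx2 /= !mx2M.
rewrite !rmorph0 e0 e1; split=> //; congr mx2; ring.
Qed.

(** The columns are first normalised with respect to the rows x_1 and y_0, the
    only ones that b multiplies by a scalar; the four echelon forms are then
    treated in turn.  The conclusion separates the split planes from the plane
    of w. *)
Lemma lagrangian2_reduce (c d : 'M[C]_2) :
    c^t* *m d = d^t* *m c ->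
    (forall v : 'M_2, c *m v = 0 -> d *m v = 0 -> v = 0) ->
  (exists c0 c1 d0 d1,
    [/\ (c0 != 0) || (d0 != 0), c0^* * d0 = d0^* * c0,
        (c1 != 0) || (d1 != 0), c1^* * d1 = d1^* * c1
      & borel_equiv (c, d) (split_pair c0 c1 d0 d1)])
  \/ borel_equiv (c, d) (mx2 0 1 1 0, 1%:M).
Proof.
move=> iso inj.
have [a ua ech] := col_echelon2 (mx2 (c 1 0) (c 1 1) (d 0 0) (d 0 1)).
have red M : borel_equiv (c *m a, d *m a) M -> borel_equiv (c, d) M.
  exact/borel_equiv_trans/(borel_equiv_mulr ua).
have {}iso : (c *m a)^t* *m (d *m a) = (d *m a)^t* *m (c *m a).
  by rewrite !adjmxM !mulmxA -(mulmxA _ _ d) iso !mulmxA.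
have {}inj (x y : C) : c *m a *m mx2 x 0 y 0 = 0 -> d *m a *m mx2 x 0 y 0 = 0 ->
    x = 0 /\ y = 0.
  set v := mx2 _ _ _ _; rewrite -!mulmxA => cv dv.
  have : v = 0 by rewrite -(mulKmx ua v) (inj _ cv dv) mulmx0.
  by rewrite mx2_0 => /mx2_inj[].
set c' := c *m a in iso inj red *; set d' := d *m a in iso inj red *.
have NE : mx2 (c 1 0) (c 1 1) (d 0 0) (d 0 1) *m a =
    mx2 (c' 1 0) (c' 1 1) (d' 0 0) (d' 0 1).
  by apply: mx2_ext; rewrite !mulmx2 !mxE.
rewrite {}NE in ech; clearbody c' d'.
rewrite [c']mx2E [d']mx2E in iso inj red.
case: ech => [||| [l]] /mx2_inj[c10 c11 d00 d01];
  rewrite c10 c11 d00 d01 in iso inj red;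
  move: iso; rewrite !adj_mx2 !mx2M => /mx2_inj[e00 e01 e10 e11];
  rewrite ?rmorph0 ?rmorph1 ?mul0r ?mulr0 ?mul1r ?mulr1 ?add0r ?addr0 in e00 e01 e10 e11;
  move: (c' 0 0) (c' 0 1) (d' 1 0) (d' 1 1) => al p de q in e00 e01 e10 e11 inj red *.
(* x_1 and y_0 independent.  Isotropy makes al and q real and de = - p^*, so a
   single unipotent b clears both off-diagonal entries. *)
- left; exists al, 1, 1, q; rewrite oner_neq0 orbT rmorph1 mulr1 mul1r.
  split=> //; first by rewrite mulr1 mul1r -e11.
  apply: red; exists (mx2 1 (- p) 0 1), 1%:M.
  rewrite mx2_unit unitmx1 mx2_trig mulr1 mulr0 subr0 oner_neq0 adj_mx2 /= !mulmx1 !mx2M.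
  have deE : de = - p^* by apply/eqP; rewrite -addr_eq0 addrC e10.
  rewrite rmorph0 rmorph1 rmorphN /= deE; split=> //; congr mx2; ring.
(* x_1 = y_0 = 0 on the plane, which is then a coordinate plane. *)
- have D0 : mx2 al p de q \in unitmx.
    rewrite mx2_unit; apply/negP => /eqP D0.
    have vanish x y : al * x + p * y = 0 -> de * x + q * y = 0 -> x = 0 /\ y = 0.
      by move=> h1 h2; apply: inj; rewrite mx2M mx2_0 ?h1 ?h2; congr mx2; ring.
    have D1 : de * p + q * - al = 0 by rewrite -oppr0 -D0; ring.
    have D2 : al * q + p * - de = 0 by rewrite -D0; ring.
    have [|//|p0 /eqP] := vanish p (- al); first by ring.
    rewrite oppr_eq0 => /eqP al0.
    have [//||q0 /eqP] := vanish q (- de); first by ring.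
    rewrite oppr_eq0 => /eqP de0.
    have [||/eqP] := vanish 1 0; rewrite ?al0 ?de0; [ring | ring |].
    by rewrite oner_eq0.
  left; exists 1, 0, 0, 1; rewrite oner_neq0 orbT rmorph0 !rmorph1 !(mul0r, mulr0).
  split=> //; apply: red.
  have cE : mx2 al p 0 0 = mx2 1 0 0 0 *m mx2 al p de q.
    by rewrite mx2M; congr mx2; ring.
  have dE : mx2 0 0 de q = mx2 0 0 0 1 *m mx2 al p de q.
    by rewrite mx2M; congr mx2; ring.
  apply: (borel_equiv_mulr (a := invmx (mx2 al p de q))); first by rewrite unitmx_inv.
    by rewrite cE mulmxK.
  by rewrite dE mulmxK.
(* x_1 = 0 on the plane but y_0 is not: isotropy kills p, and a column operation
   kills de. *)
- have q0 : q != 0.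
    apply/negP => /eqP q0.
    have [||_ /eqP] := inj 0 1; last by rewrite oner_eq0.
      by rewrite mx2M mx2_0 -e01; congr mx2; ring.
    by rewrite mx2M mx2_0 q0; congr mx2; ring.
  left; exists al, 0, 1, q; rewrite oner_neq0 q0 !orbT rmorph0 rmorph1 mulr1 mul0r mulr0.
  split=> //; first by rewrite mul1r.
  apply: red; apply: (borel_equiv_mulr (a := mx2 1 0 (- de / q) 1)).
  - by rewrite mx2_unit mulr1 mul0r subr0 oner_neq0.
  - by rewrite mx2M -e01; congr mx2; ring.
  - by rewrite mx2M; congr mx2; field.
(* y_0 = l x_1 with x_1 nonzero on the plane, where l may vanish.  Column
   operations put the identity in the first block; the second becomes Hermitian
   with corner 0. *)
- have p0 : p != 0.
    apply/negP => /eqP p0.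
    have [||_ /eqP] := inj 0 1; last by rewrite oner_eq0.
      by rewrite mx2M mx2_0 p0; congr mx2; ring.
    by rewrite mx2M mx2_0 e01 p0; congr mx2; ring.
  set ep := de - al * l^*.
  have {}red M : borel_equiv (1%:M, mx2 0 l l^* ep) M -> borel_equiv (c, d) M.
    move=> eqM; apply/red/(borel_equiv_trans _ eqM).
    apply: (borel_equiv_mulr (a := mx2 0 1 p^-1 (- al / p))).
    - by rewrite mx2_unit mul0r mul1r sub0r oppr_eq0 invr_eq0.
    - by rewrite mx2M mx2_1; congr mx2; field.
    - by rewrite mx2M e01 /ep; congr mx2; field.
  have ep_real : ep^* = ep.
    have deE : de = l^* * al + de^* - al^* * l by rewrite -e00; ring.
    by rewrite /ep {2}deE rmorphB rmorphM /= conjCK; ring.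
  have [l0|l0] := eqVneq l 0.
    left; exists 1, 1, 0, ep; rewrite oner_neq0 rmorph0 rmorph1.
    rewrite !(mulr0, mul0r, mulr1, mul1r); split=> //; apply: red.
    by rewrite /split_pair l0 rmorph0 -mx2_1; apply: borel_equiv_refl.
  right; apply: red.
  (* A factorisation mx2 0 l l^* ep = b^* w b: the shear absorbs half of the real
     entry ep, and the diagonal part of b absorbs l. *)
  have lc0 : l^* != 0 by rewrite conjC_eq0.
  have two0 : (2%:R : C) != 0 by rewrite pnatr_eq0.
  exists (mx2 l^* (ep / 2%:R) 0 1), (mx2 (- ep / (2%:R * l^*)) (l^*)^-1 1 0).
  rewrite !mx2_unit mx2_trig adj_mx2 /= !mulmx1 !mx2M conjCK rmorph0 rmorph1.
  rewrite rmorphM fmorphV rmorph_nat /= ep_real; split=> //.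
  - by rewrite mulr1 mulr0 subr0.
  - by rewrite mulr0 mulr1 sub0r oppr_eq0 invr_eq0.
  - by congr mx2; field.
  - by congr mx2; field.
Qed.

End Classification.

(** * An invariant that separates the orbits *)

Section Invariant.
Variable C : numClosedFieldType.
Implicit Types (M : 'M[C]_2 * 'M[C]_2) (v : 'cV[C]_2).

(** For the vector (x,y) = (M.1 v, M.2 v) of the plane: whether x_1 and y_0 are
    nonzero, and the sign of x^* y. *)
Definition profile M v : bool * bool * C :=
  ((M.1 *m v) 1 0 != 0, (M.2 *m v) 0 0 != 0,
   Num.sg (((M.1 *m v)^t* *m (M.2 *m v)) 0 0)).

Definition profiles M : set (bool * bool * C) := range (profile M).

Lemma adj_mul_col (v w : 'cV[C]_2) :
  (v^t* *m w) 0 0 = (v 0 0)^* * w 0 0 + (v 1 0)^* * w 1 0.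
Proof. by rewrite mulmx2 !mxE. Qed.

(** With b upper triangular, b x has lower entry b_11 x_1 and b^{-*} y has upper
    entry y_0 / conj b_00, while x^* y is unchanged; a only reparametrises the
    plane. *)
Lemma profiles_equiv M M' : borel_equiv M M' -> profiles M = profiles M'.
Proof.
move=> [b [a [ub tb ua cE dE]]].
have b10 : b 1 0 = 0 by apply/eqP; rewrite -trig_tr2.
have [b00 b11] : b 0 0 != 0 /\ b 1 1 != 0.
  have : mx2 (b 0 0) (b 0 1) (b 1 0) (b 1 1) \in unitmx by rewrite -mx2E.
  by rewrite mx2_unit b10 mulr0 subr0 mulf_eq0 negb_or => /andP.
have prE v : profile M' v = profile M (a *m v).
  have x'E : M'.1 *m v = b *m (M.1 *m (a *m v)) by rewrite cE !mulmxA.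
  have yE : M.2 *m (a *m v) = b^t* *m (M'.2 *m v) by rewrite [LHS]mulmxA -dE -mulmxA.
  rewrite /profile x'E yE; congr (_, _, Num.sg _).
  - by rewrite [in LHS]mulmx2 b10 mul0r add0r mulf_eq0 (negPf b11).
  - have bt00 : (b^t*) 0 0 = (b 0 0)^* by rewrite !mxE.
    have bt01 : (b^t*) 0 1 = 0 by rewrite !mxE b10 rmorph0.
    by rewrite [in RHS]mulmx2 bt00 bt01 mul0r addr0 mulf_eq0 conjC_eq0 (negPf b00).
  - by rewrite (adjmxM b) -[in LHS]mulmxA.
apply/seteqP; split=> _ [v _ <-]; last by rewrite prE; exists (a *m v).
by exists (invmx a *m v) => //; rewrite prE mulKVmx.
Qed.

Definition rline_sign (t : rline) : C := if t is inl s then (-1) ^+ s else 0.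

Lemma sg_rline t c d u : on_rline t c d -> u != 0 ->
  Num.sg ((c * u)^* * (d * u)) = rline_sign t.
Proof.
move=> cd u0; rewrite rmorphM /= mulrACA.
case: t cd => [s /andP[c0 /eqP->]|[] /andP[]]; last 2 first.
- by move=> _ /eqP->; rewrite mulr0 mul0r sgr0.
- by move=> /eqP-> _; rewrite rmorph0 !mul0r sgr0.
have pos : 0 < c^* * c * (u^* * u) by rewrite mulr_gt0 // -normCKC exprn_gt0 ?normr_gt0.
rewrite [c^* * _]mulrCA -mulrA.
case: s => /=; last by rewrite expr0 mul1r gtr0_sg.
by rewrite expr1 mulN1r ltr0_sg // oppr_lt0.
Qed.

Lemma split_profile c0 c1 d0 d1 v : profile (split_pair c0 c1 d0 d1) v =
  (c1 * v 1 0 != 0, d0 * v 0 0 != 0,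
   Num.sg ((c0 * v 0 0)^* * (d0 * v 0 0) + (c1 * v 1 0)^* * (d1 * v 1 0))).
Proof.
by rewrite /profile /= adj_mul_col !mulmx2 !mxE /= !mul0r !add0r !addr0.
Qed.

(** On a split plane y_0 = 0 kills the contribution of the first line to x^* y,
    so that only the second line is seen. *)
Lemma split_profiles_lower t1 c0 c1 d0 d1 s :
    on_rline t1 c1 d1 ->
  profiles (split_pair c0 c1 d0 d1) (true, false, s) <->
  c1 != 0 /\ s = rline_sign t1.
Proof.
move=> l1; split=> [[v _]|[c10 ->]].
  rewrite split_profile => -[/negPf]; rewrite mulf_eq0.
  move/norP => [c10 v1] /negbFE/eqP d0v <-.
  by rewrite d0v mulr0 add0r (sg_rline l1 v1).
exists (\col_i (if i == 0 then 0 else 1)) => //; rewrite split_profile !mxE /=.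
by rewrite !mulr0 eqxx add0r (sg_rline l1 (oner_neq0 _)) mulr1 c10.
Qed.

Lemma split_profiles_upper t0 c0 c1 d0 d1 s :
    on_rline t0 c0 d0 ->
  profiles (split_pair c0 c1 d0 d1) (false, true, s) <->
  d0 != 0 /\ s = rline_sign t0.
Proof.
move=> l0; split=> [[v _]|[d00 ->]].
  rewrite split_profile => -[/negbFE/eqP c1v /negPf]; rewrite mulf_eq0.
  move/norP => [d00 v0] <-.
  by rewrite c1v rmorph0 mul0r addr0 (sg_rline l0 v0).
exists (\col_i (if i == 0 then 1 else 0)) => //; rewrite split_profile !mxE /=.
by rewrite !mulr0 eqxx addr0 (sg_rline l0 (oner_neq0 _)) mulr1 d00.
Qed.

(** In the plane of w the functionals x_1 and y_0 coincide.  If the profiles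
    agreed, no vector of the split plane would have y_0 = 0 and x_1 <> 0, hence
    c1 = 0 and x_1 would vanish identically. *)
Lemma split_profiles_neq t1 c0 c1 d0 d1 : on_rline t1 c1 d1 ->
  profiles (split_pair c0 c1 d0 d1) <> profiles (mx2 0 1 1 0, 1%:M).
Proof.
move=> l1 E.
have w_profile v : profile (mx2 0 1 1 0, 1%:M) v = (v 0 0 != 0, v 0 0 != 0,
    Num.sg ((v 1 0)^* * v 0 0 + (v 0 0)^* * v 1 0)).
  rewrite /profile /= adj_mul_col mx2_1 !mulmx2 !mxE /=.
  by rewrite !mul0r !mul1r !add0r !addr0.
have c10 : c1 = 0.
  apply/eqP; apply: contraT => c1n.
  have : profiles (split_pair c0 c1 d0 d1)
      (profile (split_pair c0 c1 d0 d1) (\col_i (if i == 0 then 0 else 1))).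
    by eexists.
  rewrite E split_profile => -[v _]; rewrite w_profile !mxE /= mulr1 mulr0 c1n eqxx.
  by move=> [->].
have : profiles (mx2 0 1 1 0, 1%:M)
    (profile (mx2 0 1 1 0, 1%:M) (\col_i (if i == 0 then 1 else 0))) by eexists.
rewrite -E => -[v _]; rewrite split_profile w_profile c10 mul0r eqxx !mxE /=.
by rewrite oner_neq0.
Qed.

End Invariant.

Lemma on_rline_real (C : numClosedFieldType) t (c d : C) : on_rline t c d ->
  (c != 0) || (d != 0) /\ c^* * d = d^* * c.
Proof.
case: t => [s /andP[c0 /eqP->]|[] /andP[]].
- by rewrite c0 rmorphM /= signr_conj; split=> //; ring.
- by move=> -> /eqP->; rewrite rmorph0 mul0r mulr0.
- by move=> /eqP-> ->; rewrite rmorph0 orbT mul0r mulr0.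
Qed.

(** The sign of conj c * d distinguishes the line types once one of the two axes
    is set apart. *)
Lemma rline_eq (C : numClosedFieldType) (t t' : rline) (e : bool) :
    (t == inr e) = (t' == inr e) -> (t != inr e -> rline_sign C t = rline_sign C t') ->
  t = t'.
Proof.
have sgn0 (s : bool) : ((-1) ^+ s : C) == 0 = false by rewrite signr_eq0.
case: t t' => [s|x] [s'|x'] /= E sgnE.
- by have := sgnE isT; move/signr_inj->.
- by have := sgnE isT; move/eqP; rewrite sgn0.
- by have/eqP := sgnE (negbT E); rewrite eq_sym sgn0.
- move: E; rewrite !(inj_eq (@inr_inj _ _)); clear.
  by case: x x' e => [] [] [].
Qed.

Lemma on_rline_axis (C : numClosedFieldType) t (c d : C) : on_rline t c d ->
  (t == inr false) = (c == 0) /\ (t == inr true) = (d == 0).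
Proof.
case: t => [s /andP[c0 /eqP->]|[] /andP[]].
- by rewrite mulf_eq0 signr_eq0 (negPf c0).
- by move=> /negPf-> ->.
- by move=> -> /negPf->.
Qed.

Lemma rline_eq_signs (C : numClosedFieldType) (t t' : rline) (x x' : C) (e : bool) :
    (t == inr e) = (x == 0) -> (t' == inr e) = (x' == 0) ->
    (forall s : C, x != 0 /\ s = rline_sign _ t <-> x' != 0 /\ s = rline_sign _ t') ->
  t = t'.
Proof.
move=> tx tx' H; apply: (@rline_eq C _ _ e); rewrite tx ?tx'.
  apply: negb_inj; apply/idP/idP => x0.
    by case: (H (rline_sign _ t)) => /(_ (conj x0 erefl))[].
  by case: (H (rline_sign _ t')) => _ /(_ (conj x0 erefl))[].
by move=> x0; case: (H (rline_sign _ t)) => /(_ (conj x0 erefl))[].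
Qed.

Lemma norm_neq0 (C : numClosedFieldType) (x y : C) :
  (x != 0) || (y != 0) -> x^* * x + y^* * y != 0.
Proof.
by rewrite ![_^* * _]mulrC paddr_eq0 ?mul_conjC_ge0 // !mul_conjC_eq0 negb_and.
Qed.

(** * The seventeen representatives *)

Section Representatives.
Variable R : realType.
Local Notation C := R[i].

(** [Some (t0, t1)] labels the split plane with lines of types t0 and t1, and
    [None] the plane of w. *)
Definition orbit_label : Type := option (rline * rline).

Definition orbit_rep (l : orbit_label) : 'M[C]_2 * 'M[C]_2 :=
  match l with
  | Some (inl s, inl t) => ((-1) ^+ s *: E1 R + (-1) ^+ t *: E2 R, 1%:M)
  | Some (inl s, inr true) => (1%:M, (-1) ^+ s *: E1 R)
  | Some (inl s, inr false) => ((-1) ^+ s *: E1 R, 1%:M)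
  | Some (inr true, inl t) => (1%:M, (-1) ^+ t *: E2 R)
  | Some (inr true, inr true) => (1%:M, 0)
  | Some (inr true, inr false) => (E1 R, E2 R)
  | Some (inr false, inl t) => ((-1) ^+ t *: E2 R, 1%:M)
  | Some (inr false, inr true) => (E2 R, E1 R)
  | Some (inr false, inr false) => (0, 1%:M)
  | None => (wmx R, 1%:M)
  end.

Lemma reps_range : @reps R = range orbit_rep.
Proof.
apply/seteqP; split=> [_ [s t|s| |s| |s|s| | |]|_ [[[[s|[]] [t|[]]]|] _ <-]].
- by exists (Some (inl s, inl t)).
- by exists (Some (inl s, inr true)).
- by exists None.
- by exists (Some (inr false, inl s)).
- by exists (Some (inr false, inr true)).
- by exists (Some (inr true, inl s)).
- by exists (Some (inl s, inr false)).
- by exists (Some (inr true, inr true)).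
- by exists (Some (inr true, inr false)).
- by exists (Some (inr false, inr false)).
- exact: rep1.
- exact: rep2.
- exact: rep7.
- exact: rep6.
- exact: rep8.
- exact: rep9.
- exact: rep4.
- exact: rep5.
- exact: rep10.
- exact: rep3.
Qed.

Lemma orbit_rep_split t0 t1 : exists c0 c1 d0 d1 : C,
  [/\ on_rline t0 c0 d0, on_rline t1 c1 d1
    & orbit_rep (Some (t0, t1)) = split_pair c0 c1 d0 d1].
Proof.
have sq (s : bool) : (-1) ^+ s * (-1) ^+ s = 1 :> C by rewrite -expr2 sqrr_sign.
have split_eq (a b : 'M[C]_2) c0 c1 d0 d1 : a = mx2 c0 0 0 c1 -> b = mx2 d0 0 0 d1 ->
    (a, b) = split_pair c0 c1 d0 d1 by move=> -> ->.
pose sgn (s : bool) : C := (-1) ^+ s.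
have line s : on_rline (inl s) (sgn s) 1 by rewrite /= signr_eq0 sq eqxx.
have line' s : on_rline (inl s) 1 (sgn s) by rewrite /= mulr1 oner_eq0 eqxx.
have axis0 : on_rline (inr true) (1 : C) 0 by rewrite /= oner_eq0 eqxx.
have axis1 : on_rline (inr false) (0 : C) 1 by rewrite /= oner_eq0 eqxx.
case: t0 t1 => [s|[]] [t|[]];
  [ exists (sgn s), (sgn t), 1, 1 | exists 1, 1, (sgn s), 0 | exists (sgn s), 0, 1, 1
  | exists 1, 1, 0, (sgn t) | exists 1, 1, 0, 0 | exists 1, 0, 0, 1
  | exists 0, (sgn t), 1, 1 | exists 0, 1, 1, 0 | exists 0, 0, 1, 1 ];
  split=> //; apply: split_eq; apply: mx2_ext; rewrite !mxE /=;
  by rewrite ?mulr1 ?mulr0 ?addr0 ?add0r.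
Qed.

Lemma wmx_mx2 : wmx R = mx2 0 1 1 0.
Proof. by apply: mx2_ext; rewrite !mxE /= ?addr0 ?add0r. Qed.

Lemma orbit_rep_equiv_inj l l' :
  borel_equiv (orbit_rep l) (orbit_rep l') -> l = l'.
Proof.
have split_w t0 t1 : profiles (orbit_rep (Some (t0, t1))) <> profiles (orbit_rep None).
  have [c0 [c1 [d0 [d1 [l0 l1 ->]]]]] := orbit_rep_split t0 t1.
  by rewrite /orbit_rep wmx_mx2; apply: split_profiles_neq l1.
move/profiles_equiv; case: l l' => [[t0 t1]|] [[t0' t1']|] E.
- have [c0 [c1 [d0 [d1 [l0 l1 E0]]]]] := orbit_rep_split t0 t1.
  have [c0' [c1' [d0' [d1' [l0' l1' E1]]]]] := orbit_rep_split t0' t1'.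
  rewrite E0 E1 in E.
  congr (Some (_, _)).
    apply: (rline_eq_signs (on_rline_axis l0).2 (on_rline_axis l0').2) => s.
    apply: iff_trans (iff_sym (split_profiles_upper c1 d1 s l0)) _; rewrite E.
    exact: split_profiles_upper l0'.
  apply: (rline_eq_signs (on_rline_axis l1).1 (on_rline_axis l1').1) => s.
  apply: iff_trans (iff_sym (split_profiles_lower c0 d0 s l1)) _; rewrite E.
  exact: split_profiles_lower l1'.
- by case: (split_w _ _ E).
- by case: (split_w _ _ (esym E)).
- by [].
Qed.

(** Rank two is read off the Gram matrix c^* c + d^* d, which is diagonal for
    every representative. *)
Lemma orbit_rep_LMcirc l : LMcirc (col_mx (orbit_rep l).1 (orbit_rep l).2).
Proof.
have gram (c d : 'M[C]_2) : c^t* *m d = d^t* *m c -> c^t* *m c + d^t* *m d \in unitmx ->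
    LMcirc (col_mx c d).
  move=> cd; rewrite -mul_row_col -adj_col_mx gram_unit => /eqP rk.
  by exists c, d.
case: l => [[t0 t1]|]; last first.
  apply: gram; rewrite /= wmx_mx2 mx2_1 !adj_mx2 !mx2M rmorph0 rmorph1.
    by congr mx2; ring.
  rewrite mx2D mx2_unit !(mulr0, mul0r, mulr1, addr0, add0r) subr0.
  by rewrite mulf_neq0 // (pnatr_eq0 C 2).
have [c0 [c1 [d0 [d1 [l0 l1 ->]]]]] := orbit_rep_split t0 t1.
have [n0 r0] := on_rline_real l0; have [n1 r1] := on_rline_real l1.
apply: gram; rewrite /= !adj_mx2 !mx2M rmorph0 !mulr0 !mul0r !addr0 !add0r.
  by rewrite r0 r1.
by rewrite mx2D !addr0 mx2_unit mulr0 subr0 mulf_neq0 ?norm_neq0.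
Qed.

Lemma LMcirc_nondegenerate (c d : 'M[C]_2) : LMcirc (col_mx c d) ->
  c^t* *m d = d^t* *m c /\ (forall v : 'M_2, c *m v = 0 -> d *m v = 0 -> v = 0).
Proof.
move=> [c' [d' [/eq_col_mx[-> ->] cd rk]]]; split=> // v cv dv.
have := gram_unit (col_mx c' d'); rewrite rk eqxx => u.
by rewrite -(mulKmx u v) -mulmxA mul_col_mx cv dv col_mx0 mulmx0 mulmx0.
Qed.

Lemma orbit_rep_exhaustive (c d : 'M[C]_2) : LMcirc (col_mx c d) ->
  exists l, borel_equiv (c, d) (orbit_rep l).
Proof.
move=> /LMcirc_nondegenerate[iso inj].
have [[c0 [c1 [d0 [d1 [n0 r0 n1 r1 red]]]]]|red] := lagrangian2_reduce iso inj.
  have [t0 [t1 tr]] := split_pair_transitive n0 r0 n1 r1.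
  have [c0' [c1' [d0' [d1' [l0 l1 E]]]]] := orbit_rep_split t0 t1.
  by exists (Some (t0, t1)); rewrite E; apply: borel_equiv_trans red (tr _ _ _ _ l0 l1).
by exists None; rewrite /= wmx_mx2.
Qed.

End Representatives.

Lemma borelGL2_mxgroup (R : realType) : mxgroup (@borelGL R 2).
Proof.
split.
- by split; [exact: unitmx1 | rewrite trig_tr2 mxE].
- by move=> b [].
- move=> b b' [ub tb] [ub' tb']; split; first by rewrite unitmx_mul ub.
  move: tb tb'; rewrite !trig_tr2 mulmx2 => /eqP-> /eqP->.
  by rewrite mul0r mulr0 addr0.
- move=> b [ub]; rewrite trig_tr2 => /eqP b10; split; first by rewrite unitmx_inv.
  have : mx2 (b 0 0) (b 0 1) (b 1 0) (b 1 1) \in unitmx by rewrite -mx2E.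
  rewrite mx2_unit b10 mulr0 subr0 mulf_eq0 negb_or => /andP[_ b11].
  have : (b *m invmx b) 1 0 = 0 by rewrite mulmxV // mxE.
  rewrite mulmx2 b10 mul0r add0r trig_tr2 => /eqP.
  by rewrite mulf_eq0 (negPf b11).
Qed.

Lemma reps_Borbit_bij (R : realType) :
  set_bij (@reps R) (@BGP R 2) (fun cd => Borbit (GP_point cd.1 cd.2)).
Proof.
have gB := borelGL2_mxgroup R.
rewrite reps_range; split.
- move=> _ [l _ <-]; exists (GP_point (orbit_rep R l).1 (orbit_rep R l).2) => //.
  exact: (GP_pointP (orbit_rep_LMcirc R l)).1.
- move=> _ _ /set_mem[l _ <-] /set_mem[l' _ <-].
  move/(Borbit_GP_point gB (orbit_rep_LMcirc R l) (orbit_rep_LMcirc R l')).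
  by rewrite -!surjective_pairing => /orbit_rep_equiv_inj->.
- move=> _ [_ [g Ug <-] <-].
  have LMg := LMcirc_mull Ug (M0_LMcirc R 2).
  have gM := vsubmxK (g *m col_mx 1%:M 0); rewrite -gM in LMg.
  have [l eql] := orbit_rep_exhaustive LMg.
  exists (orbit_rep R l); first by exists l.
  rewrite -(GP_point_coset Ug (esym gM)); apply/esym.
  apply/(Borbit_GP_point gB LMg (orbit_rep_LMcirc R l)).
  by rewrite -surjective_pairing.
Qed.

Lemma card_orbit_label : ([set: orbit_label] #= `I_17)%card.
Proof.
pose T : finType := option ((bool + bool) * (bool + bool)).
have cardT : #|T| = 17%N by rewrite card_option card_prod card_sum card_bool.
have := @inj_card_eq _ _ [set: T] (fun l => nat_of_ord (enum_rank l)).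
move=> H; apply: card_esym; apply: card_eq_trans (H _).
  rewrite (_ : [set _ | _ in _] = `I_17) //; apply/seteqP; split=> [_ [l _ <-]|k ltk].
    by rewrite /= -cardT ltn_ord.
  have ltk' : (k < #|T|)%N by rewrite cardT.
  by exists (enum_val (Ordinal ltk')) => //; rewrite enum_valK.
by move=> l l' _ _ /ord_inj/enum_rank_inj.
Qed.

(** The orbits are counted through the labels, which exceed by one the 4 * 4
    pairs of line types. *)
Lemma card_BGP (R : realType) : (@BGP R 2 #= `I_17)%card.
Proof.
have [fun_ inj surj] := reps_Borbit_bij R.
pose f l := Borbit (GP_point (orbit_rep R l).1 (orbit_rep R l).2).
have repsl l : reps (orbit_rep R l) by rewrite reps_range; exists l.
have -> : @BGP R 2 = [set f l | l in [set: orbit_label]].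
  apply/seteqP; split=> [O /surj[cd]|_ [l _ <-]]; last exact: fun_.
  by rewrite reps_range => -[l _ <-] <-; exists l.
apply: card_eq_trans card_orbit_label; apply: inj_card_eq => l l' _ _ eqf.
have E : orbit_rep R l = orbit_rep R l' by apply: inj => //; apply/mem_set.
by apply: (@orbit_rep_equiv_inj R); rewrite E; apply: borel_equiv_refl.
Qed.

Theorem theorem1p2 (R : realType) :
  [/\ set_bij (@GmodP R 2) (@LMmodGL R 2) (@ident R 2),
      (forall g : 'M[R[i]]_(2 + 2), Upp g ->
         ident (ltranslate g (@Pgrp R 2)) = GLclass (g *m col_mx 1%:M 0))
    & (forall (g : 'M[R[i]]_(2 + 2)) (x : set 'M[R[i]]_(2 + 2)),
         Upp g -> GmodP x -> ident (ltranslate g x) = ltranslate g (ident x))]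
  /\
  (set_bij (@BGP R 2) (@HHBGP R 2) (@orbit_corr R 2) /\
   forall x : set 'M[R[i]]_(2 + 2),
     GmodP x -> orbit_corr (Borbit x) = Horbit (@Bgrp R 2, x))
  /\
  (forall c d : 'M[R[i]]_2, reps (c, d) ->
     [/\ LMcirc (col_mx c d), GmodP (GP_point c d)
       & ident (GP_point c d) = GLclass (col_mx c d)])
  /\
  set_bij (@reps R) (@BGP R 2) (fun cd => Borbit (GP_point cd.1 cd.2))
  /\
  set_bij (@reps R) (@HHBGP R 2)
    (fun cd => Horbit (@Bgrp R 2, GP_point cd.1 cd.2))
  /\
  (@BGP R 2 #= `I_17)%card.
Proof.
have gB := borelGL2_mxgroup R.
split; [split | split; [split | split; [|split; [|split]]]].
- exact: ident_bij.
- by move=> g _; apply: ident_coset.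
- by move=> g X _; apply: ident_ltranslate.
- exact: orbit_corr_bij.
- by move=> X _; apply: orbit_corr_Borbit.
- move=> c d; rewrite reps_range => -[l _ cdE].
  have LMcd := orbit_rep_LMcirc R l; rewrite cdE in LMcd.
  by have [] := GP_pointP LMcd.
- exact: reps_Borbit_bij.
- have := set_bij_comp (reps_Borbit_bij R) (orbit_corr_bij gB).
  rewrite (_ : _ \o _ = fun cd => Horbit (@Bgrp R 2, GP_point cd.1 cd.2)) //.
  by apply/funext => cd /=; apply: orbit_corr_Borbit.
- exact: card_BGP.
Qed.
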